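(* Assume that for all $t\in\{0,\dots,T\}$ every finite collection $\{X^\theta\}_{\theta\in\Theta}\subseteq\mathscr L_t(\mathbb R^d)$ admits a supremum with respect to $\preceq^t$. Assume further that the preorder $\preceq$ is antisymmetric (i.e. $x\preceq y$ and $y\preceq x$ imply $x=y$) and that the family of models $\Theta$ is $\preceq$-rectangular. Then $$\mathcal V_t(S_t)=\mathcal R_t(S_t,\mathcal V_{t+1})=\mathcal B_t(S_t)$$ for every time $t=0,1,\dots,T-1$ and every state $S_t$.
   Context: Probabilistic setting. $(\Omega,\mathscr F)$ is a measurable space, $T\in\mathbb N$, $(\mathscr F_t)_{t=0,\dots,T}$ is the observation filtration, $\Theta\subset\mathbb R^d$ is a non-empty finite set, and $\{\mathbb Q_\theta:\theta\in\Theta\}$ is a family of probability measures on $(\Omega,\mathscr F)$, absolutely continuous with respect to a reference probability measure $\mathbb P$. $\mathbb E^\theta_t$ is the conditional expectation under $\mathbb Q_\theta$ given $\mathscr F_t$. All equalities, inequalities and inclusions are in the $\mathbb P$-a.s. sense. $\mathscr L_t(\mathbb R^d):=L^1(\Omega,\mathscr F_t,\mathbb P;\mathbb R^d)$. Conditional expectations $\mathbb E^\theta_t[X]$, $X\in\mathscr L_s(\mathbb R^d)$, $s\ge t$, are understood to be well-defined elements of $\mathscr L_t(\mathbb R^d)$, determined up to $\mathbb P$-null sets. Order. $\preceq$ is a fixed vector preorder on $\mathbb R^d$ (reflexive, transitive, and $x\preceq y$ implies $x+z\preceq y+z$ and $\alpha x\preceq\alpha y$ for $z\in\mathbb R^d$,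 $\alpha\ge0$), with ordering cone $C=\{x\in\mathbb R^d:0\preceq x\}$ (a convex cone containing $0$). $\mathscr L_t(C)\subseteq\mathscr L_t(\mathbb R^d)$ is the set of elements with values in $C$; for $X,Y\in\mathscr L_t(\mathbb R^d)$, $X\preceq^tY$ iff $Y-X\in\mathscr L_t(C)$. Supremum. A supremum of $\{X^\theta\}_{\theta\in\Theta}\subseteq\mathscr L_t(\mathbb R^d)$ with respect to $\preceq^t$ is a $V\in\mathscr L_t(\mathbb R^d)$ such that (i) $X^\theta\preceq^tV$ for all $\theta\in\Theta$, and (ii) if $A\in\mathscr L_t(\mathbb R^d)$ satisfies $X^\theta\preceq^tA$ for all $\theta$, then $V\preceq^tA$. $\operatorname{v-sup}^t_{\theta\in\Theta}X^\theta$ denotes a supremum (one arbitrarily chosen if there are several; it is $\mathbb P$-a.s. unique when $\preceq$ is antisymmetric). Rectangularity. $\Theta$ is $\preceq$-rectangular if for all $t=0,\dots,T-1$ and all $X\in\mathscr L_T(\mathbb R^d)$, $$\operatorname{v-sup}^t_{\theta\in\Theta}\mathbb E^\theta_t\Big[\operatorname{v-sup}^{t+1}_{\theta'\in\Theta}\mathbb E^{\theta'}_{t+1}[X]\Big]\preceq^t\operatorname{v-sup}^t_{\theta\in\Theta}\mathbb E^\theta_t[X].$$ Control setting. $S_{t+1}=F(t,S_t,\varphi_t,Z_{t+1})$, $t=0,\dots,T-1$, $S_0=s$, where $S$ takes values in a measurable space $\mathbb S\subset\mathbb R^m$, $Z$ is an $\mathbb R^k$-valued random sequence, the controls $\varphi_t$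 take values in a compact set $A$, and $F$ is measurable. Given the state $S_t$ at time $t$, $\mathfrak A_t(S_t)$ is the set of admissible one-step controls $\varphi_t$ and $\mathfrak A^t(S_t)$ is the set of admissible controls $\varphi=(\varphi_t,\dots,\varphi_{T-1})$ starting at time $t$; one has $(\varphi_t,\tilde\varphi)\in\mathfrak A^t(S_t)$ iff $\varphi_t\in\mathfrak A_t(S_t)$ and $\tilde\varphi\in\mathfrak A^{t+1}(F(t,S_t,\varphi_t,Z_{t+1}))$. $S^\varphi_T$ is the terminal state generated from $S_t$ by $\varphi$, and states $S_t$ are $\mathscr F_t$-measurable. $\ell:\mathbb S\to\mathbb R^d$ is a loss function, with $\ell(S^\varphi_T)\in\mathscr L_T(\mathbb R^d)$ for admissible $\varphi$. Value functions. $\mathcal V_T(S_T)=\mathcal B_T(S_T)=\{\ell(S_T)\}$ and, for $t=0,\dots,T-1$, $$\mathcal V_t(S_t)=\Big\{\operatorname{v-sup}^t_{\theta\in\Theta}\mathbb E^\theta_t[\ell(S^\varphi_T)]:\varphi\in\mathfrak A^t(S_t)\Big\},$$ $$\mathcal R_t(S_t,\mathcal V_{t+1})=\Big\{\operatorname{v-sup}^t_{\theta\in\Theta}\mathbb E^\theta_t[X]:\varphi_t\in\mathfrak A_t(S_t),\ X\in\mathcal V_{t+1}(F(t,S_t,\varphi_t,Z_{t+1}))\Big\},$$ and, recursively for $t=T-1,\dots,0$, $$\mathcal B_t(S_t)=\Big\{\operatorname{v-sup}^t_{\theta\in\Theta}\mathbb E^\theta_t[X]:\varphi_t\in\mathfrak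 A_t(S_t),\ X\in\mathcal B_{t+1}(F(t,S_t,\varphi_t,Z_{t+1}))\Big\}.$$ *)

(* Defs.v *)
From HB Require Import structures.
From mathcomp Require Import all_boot all_order all_algebra.
From mathcomp Require Import all_classical all_reals all_analysis.

Set Implicit Arguments.
Unset Strict Implicit.
Unset Printing Implicit Defensive.

Import Order.TTheory GRing.Theory Num.Theory.
Import numFieldNormedType.Exports.

Local Open Scope classical_set_scope.
Local Open Scope ring_scope.

(* R^n with its Borel sigma-algebra, presented as the sigma-algebra generated
   by the coordinate maps (R carries the Borel sigma-algebra). *)
Definition coord_cylinders (R : realType) (n : nat) : set (set 'rV[R]_n) :=
  [set B | exists i : 'I_n, exists2 C : set R,
             measurable C & B = (fun x : 'rV[R]_n => x 0 i) @^-1` C].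

Definition borel_rV (R : realType) (n : nat) :=
  g_sigma_algebraType (@coord_cylinders R n).

Definition borel_space (U : ptopologicalType) :=
  g_sigma_algebraType (@open U).

(* Measurability of the restriction of f to D, D carrying the trace
   sigma-algebra (D itself need not be measurable). *)
Definition measurable_on d1 d2 (T1 : measurableType d1) (T2 : measurableType d2)
    (D : set T1) (f : T1 -> T2) :=
  forall B : set T2, measurable B ->
    exists2 E : set T1, measurable E & D `&` f @^-1` B = D `&` E.

Record vector_preorder (R : realType) (d : nat)
    (prec : 'rV[R]_d -> 'rV[R]_d -> Prop) : Prop := {
  vprec_refl : forall x, prec x x ;
  vprec_trans : forall x y z, prec x y -> prec y z -> prec x z ;
  vprec_add : forall x y z, prec x y -> prec (x + z) (y + z) ;
  vprec_scale : forall (a : R) x y, 0 <= a -> prec x y -> prec (a *: x) (a *: y)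
}.

Definition vantisymmetric (R : realType) (d : nat)
    (prec : 'rV[R]_d -> 'rV[R]_d -> Prop) : Prop :=
  forall x y, prec x y -> prec y x -> x = y.

Definition ordering_cone (R : realType) (d : nat)
    (prec : 'rV[R]_d -> 'rV[R]_d -> Prop) : set 'rV[R]_d :=
  [set x | prec 0 x].

Section RandomVectors.
Context {R : realType} {dO : measure_display} {Om : measurableType dO}.

Definition filtration (T : nat) (Fil : nat -> set (set Om)) : Prop :=
  [/\ forall t, (t <= T)%N -> sigma_algebra setT (Fil t),
      forall t, (t <= T)%N -> Fil t `<=` measurable &
      forall s t, (s <= t)%N -> (t <= T)%N -> Fil s `<=` Fil t].

(* X is measurable with respect to the sub-sigma-algebra G. *)
Definition sub_measurable (G : set (set Om)) (n : nat) (X : Om -> 'rV[R]_n) :=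
  forall B : set (borel_rV R n), measurable B -> G (X @^-1` B).

Definition vintegrable (mu : probability Om R) (n : nat) (X : Om -> 'rV[R]_n) :=
  forall i : 'I_n, mu.-integrable [set: Om] (fun w => (X w 0 i)%:E).

(* Representatives of the elements of L^1(Om, G, P; R^n). *)
Definition L1 (P : probability Om R) (G : set (set Om)) (n : nat) :
    set (Om -> 'rV[R]_n) :=
  [set X | sub_measurable G X /\ vintegrable P X].

Definition as_eq (P : probability Om R) (n : nat) (X Y : Om -> 'rV[R]_n) :=
  {ae P, forall w, X w = Y w}.

(* Equality of two sets of random vectors, both read modulo P-null sets. *)
Definition as_eqset (P : probability Om R) (n : nat)
    (V W : set (Om -> 'rV[R]_n)) : Prop :=
  (forall X, V X -> exists2 Y, W Y & as_eq P X Y) /\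
  (forall Y, W Y -> exists2 X, V X & as_eq P X Y).

Definition is_cond_exp (Q : probability Om R) (G : set (set Om)) (n : nat)
    (X Y : Om -> 'rV[R]_n) : Prop :=
  [/\ vintegrable Q X, sub_measurable G Y, vintegrable Q Y &
      forall A, G A -> forall i : 'I_n,
        (\int[Q]_(w in A) (Y w 0 i)%:E = \int[Q]_(w in A) (X w 0 i)%:E)%E].

End RandomVectors.

Section RobustModel.
Context {R : realType} {dO : measure_display} {Om : measurableType dO}.
Context {d : nat}.
Variables (P : probability Om R) (T : nat) (Fil : nat -> set (set Om)).
Variables (Theta : set 'rV[R]_d) (Q : 'rV[R]_d -> probability Om R).
Variable prec : 'rV[R]_d -> 'rV[R]_d -> Prop.

Local Notation rvec := (Om -> 'rV[R]_d).
Local Notation L t := (L1 P (Fil t) (n := d)).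

(* X is below Y iff Y - X belongs to L_t(C). *)
Definition prec_t (t : nat) (X Y : rvec) : Prop :=
  L t (fun w => Y w - X w) /\
  {ae P, forall w, ordering_cone prec (Y w - X w)}.

(* Families indexed by Theta are functions on R^d of which only the values on
   Theta matter. *)
Definition is_vsup (t : nat) (X : 'rV[R]_d -> rvec) (V : rvec) : Prop :=
  [/\ L t V,
      forall theta, Theta theta -> prec_t t (X theta) V &
      forall A, L t A -> (forall theta, Theta theta -> prec_t t (X theta) A) ->
        prec_t t V A].

Definition vsup (t : nat) (X : 'rV[R]_d -> rvec) : rvec :=
  xget (fun=> 0) [set V | is_vsup t X V].

Definition finite_sups : Prop :=
  forall t, (t <= T)%N -> forall X : 'rV[R]_d -> rvec,
    (forall theta, Theta theta -> L t (X theta)) -> exists V, is_vsup t X V.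

Definition is_cexp (theta : 'rV[R]_d) (t : nat) (X Y : rvec) : Prop :=
  L t Y /\ is_cond_exp (Q theta) (Fil t) X Y.

Definition cexp (theta : 'rV[R]_d) (t : nat) (X : rvec) : rvec :=
  xget (fun=> 0) [set Y | is_cexp theta t X Y].

(* The conditional expectations under the models are well-defined elements of
   L_t(R^d), determined up to P-null sets (and not only up to null sets of the
   model). *)
Definition cexp_well_defined : Prop :=
  forall theta s t X, Theta theta -> (t <= s)%N -> (s <= T)%N -> L s X ->
    (exists Y, is_cexp theta t X Y) /\
    (forall Y Y', is_cexp theta t X Y -> is_cexp theta t X Y' -> as_eq P Y Y').

Definition rectangular : Prop :=
  forall t X, (t < T)%N -> L T X ->
    prec_t t
      (vsup t (fun theta =>
         cexp theta t (vsup t.+1 (fun theta' => cexp theta' t.+1 X))))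
      (vsup t (fun theta => cexp theta t X)).

Section Control.
Context {m k : nat} {U : ptopologicalType}.
Variables (SS : set 'rV[R]_m) (A : set U).
Variable F : nat -> 'rV[R]_m -> U -> 'rV[R]_k -> 'rV[R]_m.
Variable Z : nat -> Om -> 'rV[R]_k.
Variable Adm : nat -> (Om -> 'rV[R]_m) -> set (Om -> U).
Variable ell : 'rV[R]_m -> 'rV[R]_d.

Definition is_state (t : nat) (S : Om -> 'rV[R]_m) : Prop :=
  (forall w, SS (S w)) /\ sub_measurable (Fil t) S.

Definition next_state (t : nat) (S : Om -> 'rV[R]_m) (u : Om -> U) :
    Om -> 'rV[R]_m :=
  fun w => F t (S w) (u w) (Z t.+1 w).

Definition control_setting : Prop :=
  [/\ compact A,
      forall t, (t < T)%N ->
        (forall x u z, SS x -> A u -> SS (F t x u z)) /\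
        @measurable_on _ _ (borel_rV R m * borel_space U * borel_rV R k)%type
          (borel_rV R m) (SS `*` A `*` setT)
          (fun p => F t p.1.1 p.1.2 p.2),
      forall t, (t < T)%N ->
        sub_measurable (@measurable _ Om) (Z t.+1),
      forall t S u, (t < T)%N -> is_state t S -> Adm t S u ->
        forall w, A (u w) &
      forall t S u, (t < T)%N -> is_state t S -> Adm t S u ->
        sub_measurable (Fil t.+1) (next_state t S u)].

(* A control started at time t is the list of its one-step controls at the
   times t, ..., T - 1; at time T only the empty list is admissible. *)
Fixpoint admissible (t : nat) (S : Om -> 'rV[R]_m) (phi : seq (Om -> U)) :
    Prop :=
  if phi is u :: phi' then
    [/\ (t < T)%N, Adm t S u & admissible t.+1 (next_state t S u) phi']
  else t = T.

Fixpoint terminal_state (t : nat) (S : Om -> 'rV[R]_m) (phi : seq (Om -> U)) :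
    Om -> 'rV[R]_m :=
  if phi is u :: phi' then terminal_state t.+1 (next_state t S u) phi' else S.

Definition terminal_loss (t : nat) (S : Om -> 'rV[R]_m)
    (phi : seq (Om -> U)) : rvec :=
  fun w => ell (terminal_state t S phi w).

Definition value (t : nat) (S : Om -> 'rV[R]_m) : set rvec :=
  if (t < T)%N then
    [set Y | exists2 phi, admissible t S phi &
       Y = vsup t (fun theta => cexp theta t (terminal_loss t S phi))]
  else [set (fun w => ell (S w))].

Definition bellman (t : nat) (S : Om -> 'rV[R]_m)
    (W : (Om -> 'rV[R]_m) -> set rvec) : set rvec :=
  [set Y | exists u X, [/\ Adm t S u, W (next_state t S u) X &
       Y = vsup t (fun theta => cexp theta t X)]].

(* [backward n t] is the backward recursion with n steps left, from time t. *)
Fixpoint backward (n t : nat) (S : Om -> 'rV[R]_m) : set rvec :=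
  if n is n'.+1 then bellman t S (backward n' t.+1)
  else [set (fun w => ell (S w))].

Definition bellman_value (t : nat) (S : Om -> 'rV[R]_m) : set rvec :=
  backward (T - t) t S.

End Control.
End RobustModel.

(* Main.v *)
Require Import Defs.
From HB Require Import structures.
From mathcomp Require Import all_boot all_order all_algebra.
From mathcomp Require Import all_classical all_reals all_analysis.
From mathcomp Require Import measurable_realfun lra.

(** The whole theorem rests on one identity (lemma [robust_tower]): almost
    surely,
      [v-sup_t E_t[X] = v-sup_t E_t[v-sup_(t+1) E_(t+1)[X]]].
    Granting it, a control started at [t] is a one-step control followed by a
    control started at [t+1], so the value function satisfies the Bellman
    equation, and a backward induction identifies it with the recursion.

    In the identity, rectangularity is the inequality from right to left.  The
    other one says that conditional expectations respect the order: from
    [E_(t+1)[X] <= W] one wants [E_t[X] = E_t[E_(t+1)[X]] <= E_t[W], i.e. that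
    the conditional expectation of a random vector with values in the ordering
    cone [C] has values in [C].  The cone is neither closed nor assumed
    measurable, so separation by countably many linear functionals is not
    available; the assumptions on suprema are what gives [C] enough structure.

    - If there is only one model, suprema of one-element families are the
      elements themselves and the identity is the tower property.
    - If there are two distinct models, apply the existence of suprema to the
      deterministic family taking the values [x] and [0].  The supremum [V] is
      below almost all of its own values, and this forces it to be almost
      surely constant: extend the order to a total one by Zorn's lemma, write
      the total order lexicographically, and treat one linear functional at a
      time, using that a real random variable below almost all its own values
      is equal to its mean.  So every [x] has a deterministic positive part:
      [R^d] is a vector lattice ([models_pos_part]).
    - In a vector lattice of dimension [d] a family of pairwise disjoint nonzero
      positive elements is linearly independent.  Take such a family of maximal
      size.  Below each of its members the order is total, so the vectors whose
      negative part is disjoint from that member form a total cone, and [C] is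
      the intersection of these finitely many total cones
      ([lattice_cone_lex]).
    - A total cone of [R^n] is defined by a finite list of linear functionals
      read lexicographically ([total_cone_lex]): an order unit [u] exists, the
      map [x |-> inf {r | x <= r u}] is linear, and one goes on in its kernel.
    - Conditional expectation preserves such a lexicographic positivity
      ([cond_exp_lexpos]): if the first functional [l] satisfies [l X >= 0] then
      [l E[X|G] >= 0], and on the event [l E[X|G] = 0], which is in [G], also
      [l X = 0], so that the next functional takes over.
    - This is an assertion about events of [G], almost sure under a model.  It
      passes to the reference measure because conditional expectations under a
      model are determined up to null sets of the reference measure, which makes
      the two measures equivalent on [F_t] ([cexp_null]). *)

Set Implicit Arguments.
Unset Strict Implicit.
Unset Printing Implicit Defensive.

Import Order.TTheory GRing.Theory Num.Theory.
Import numFieldNormedType.Exports.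

Local Open Scope classical_set_scope.
Local Open Scope ring_scope.

(** * Total cones are lexicographic *)

Definition is_cone (R : realType) (n : nat) (K : set 'rV[R]_n) : Prop :=
  [/\ K 0, forall x y, K x -> K y -> K (x + y) &
      forall a x, 0 <= a -> K x -> K (a *: x)].

Definition total_cone (R : realType) (n : nat) (K : set 'rV[R]_n) : Prop :=
  is_cone K /\ forall x, K x \/ K (- x).

Definition pointed (R : realType) (n : nat) (K : set 'rV[R]_n) : Prop :=
  forall x, K x -> K (- x) -> x = 0.

Definition lin (R : realType) (n : nat) (l : 'cV[R]_n) (x : 'rV[R]_n) : R :=
  (x *m l) 0 0.

(** The empty list accepts every vector, so that the cone defined by a list need
    not be pointed: total preorders are covered as well as total orders. *)
Fixpoint lexpos (R : realType) (n : nat) (ls : seq 'cV[R]_n) (x : 'rV[R]_n) :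
    bool :=
  if ls is l :: ls' then (0 < lin l x) || (lin l x == 0) && lexpos ls' x
  else true.

Section TotalCones.
Variable R : realType.

Lemma linN n (l : 'cV[R]_n) x : lin l (- x) = - lin l x.
Proof. by rewrite /lin mulNmx mxE. Qed.

Lemma linB n (l : 'cV[R]_n) x y : lin l (x - y) = lin l x - lin l y.
Proof. by rewrite /lin mulmxBl !mxE. Qed.

Lemma cone_sum n (K : set 'rV[R]_n) (I : Type) (s : seq I) (p : pred I) f :
  is_cone K -> (forall i, p i -> K (f i)) -> K (\sum_(i <- s | p i) f i).
Proof. by move=> [K0 Kadd _] Kf; elim/big_ind: _. Qed.

Lemma total_cone_ub n (K : set 'rV[R]_n) (s : seq 'rV[R]_n) :
  total_cone K -> exists u, forall x, x \in s -> K (u - x).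
Proof.
move=> [[K0 Kadd _] tot]; elim: s => [|y s [u uP]]; first by exists 0.
case: (tot (u - y)) => [Kuy|Kyu].
  by exists u => x; rewrite inE => /orP[/eqP->|/uP].
rewrite opprB in Kyu; exists y => x; rewrite inE => /orP[/eqP->|/uP Kux].
  by rewrite subrr.
by rewrite -(subrK u y) -addrA; exact: Kadd.
Qed.

(** A common upper bound of the basis vectors and of their opposites is an order
    unit. *)
Lemma total_cone_unit n (K : set 'rV[R]_n) : total_cone K ->
  exists2 u, K u & forall x : 'rV[R]_n,
    exists2 M : R, 0 <= M & K (M *: u - x) /\ K (M *: u + x).
Proof.
move=> tK; have [[K0 Kadd Ksc] tot] := tK.
pose b (i : 'I_n) : 'rV[R]_n := delta_mx 0 i.
have [u uP] := total_cone_ub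
  (0 :: [seq b i | i <- enum 'I_n] ++ [seq - b i | i <- enum 'I_n]) tK.
have Ku : K u by rewrite -(subr0 u); apply: uP; rewrite inE eqxx.
have Kub i : K (u - b i).
  by apply: uP; rewrite inE mem_cat map_f ?mem_enum ?orbT.
have Kubp i : K (u + b i).
  rewrite -(opprK (b i)); apply: uP; rewrite inE mem_cat.
  by rewrite (map_f (fun i => - b i)) ?mem_enum ?orbT.
exists u => // x; exists (\sum_i `|x 0 i|); first by apply: sumr_ge0.
have sgn (y : 'rV[R]_n) : K ((\sum_i `|y 0 i|) *: u + y).
  rewrite [X in _ + X]row_sum_delta scaler_suml -big_split /=.
  apply: cone_sum => // i _; rewrite -/(b i).
  have [yi|/ltW yi] := leP 0 (y 0 i).
    by rewrite ger0_norm// -scalerDr; exact: Ksc.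
  have -> : `|y 0 i| *: u + y 0 i *: b i = (- y 0 i) *: (u - b i).
    by rewrite ler0_norm// scalerBr [in RHS]scaleNr [- y 0 i *: b i]scaleNr
      opprK scaleNr.
  by apply: Ksc; rewrite ?oppr_ge0.
split => //; have := sgn (- x); congr (K (_ *: u + _)).
by apply: eq_bigr => i _; rewrite mxE normrN.
Qed.

(** With an order unit [u], every [x] is infinitely close to exactly one
    multiple [r u]: by totality the multiples of [u] above [x] and those below
    [x] form a Dedekind cut.  Uniqueness of [r] makes it a linear function of
    [x], and it is nonnegative on [K] and equal to [1] at [u]. *)
Lemma total_cone_functional n (K : set 'rV[R]_n) x0 : total_cone K -> ~ K x0 ->
  exists2 l : 'cV[R]_n, l != 0 & forall x, K x -> 0 <= lin l x.
Proof.
move=> tK nK; have [[K0 Kadd Ksc] tot] := tK.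
have [u Ku uP] := total_cone_unit tK.
have Ksu a : 0 <= a -> K (a *: u) by move=> a0; exact: Ksc.
have nKu a : a < 0 -> ~ K (a *: u).
  move=> a0 Kau; apply: nK; have [M M0 [_ Mx]] := uP x0.
  have -> : x0 = (M *: u + x0) + (M / - a) *: (a *: u).
    rewrite scalerA invrN mulrN mulNr divfK ?lt_eqF// scaleNr.
    by rewrite addrAC subrr add0r.
  by apply: Kadd => //; apply: Ksc => //; rewrite divr_ge0// oppr_ge0 ltW.
(* [r] is the cut between the multiples of [u] below and above [x]. *)
pose val (x : 'rV[R]_n) (r : R) := (forall s, r < s -> K (s *: u - x)) /\
                (forall s, s < r -> K (x - s *: u)).
have val_ex (x : 'rV[R]_n) : exists r, val x r.
  pose E := [set s : R | K (s *: u - x)].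
  have [M M0 [Mx MNx]] := uP x.
  have Elb : lbound E (- M).
    move=> s Es; rewrite leNgt; apply/negP => sM.
    apply: (nKu (s + M)); first by lra.
    by rewrite scalerDl -(subrK x (s *: u)) -addrA [x + _]addrC; exact: Kadd.
  have hE : has_inf E by split; [exists M|exists (- M)].
  exists (inf E); split => s rs.
    have [e Ee es] := inf_lt hE.1 rs.
    have -> : s *: u - x = (e *: u - x) + (s - e) *: u.
      by rewrite scalerBl addrAC addrCA subrr addr0.
    by apply: Kadd => //; apply: Ksu; lra.
  case: (tot (s *: u - x)) => [Es|]; last by rewrite opprB.
  by have := ge_inf hE.2 Es; rewrite leNgt rs.
have val_uniq x r r' : val x r -> val x r' -> r <= r'.
  move=> [_ rx] [r'x _]; rewrite leNgt; apply/negP => r'r.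
  pose s := (r + r' *+ 2) / 3; pose s' := (r *+ 2 + r') / 3.
  have rs : r' < s by rewrite /s; lra.
  have rs' : s' < r by rewrite /s'; lra.
  apply: (nKu (s - s')); first by rewrite /s /s'; lra.
  rewrite scalerBl -(subrK x (s *: u)) -addrA.
  by apply: Kadd; [exact: r'x|exact: rx].
have val0 : val 0 0.
  split=> s s0; first by rewrite subr0; apply: Ksu; lra.
  by rewrite sub0r -scaleNr; apply: Ksu; lra.
have valD x y r q : val x r -> val y q -> val (x + y) (r + q).
  move=> [xr rx] [yq qy]; split=> s rs.
    (* [s - (r + q)] is shared equally between [x] and [y]. *)
    have -> : s *: u - (x + y) =
        ((s + r - q) / 2 *: u - x) + ((s - r + q) / 2 *: u - y).
      by rewrite addrACA -scalerDl opprD; congr (_ *: _ + _); lra.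
    by apply: Kadd; [apply: xr|apply: yq]; lra.
  have -> : (x + y) - s *: u =
      (x - (s + r - q) / 2 *: u) + (y - (s - r + q) / 2 *: u).
    by rewrite addrACA -opprD -scalerDl; congr (_ - _ *: _); lra.
  by apply: Kadd; [apply: rx|apply: qy]; lra.
have valN x r : val x r -> val (- x) (- r).
  move=> [xr rx]; split=> s rs.
    have -> : s *: u - - x = x - (- s) *: u by rewrite scaleNr !opprK addrC.
    by apply: rx; lra.
  have -> : - x - s *: u = (- s) *: u - x by rewrite scaleNr addrC.
  by apply: xr; lra.
have valZp a x r : 0 < a -> val x r -> val (a *: x) (a * r).
  move=> a0 [xr rx]; have a1 : a * a^-1 = 1 by rewrite divff ?gt_eqF.
  split=> s rs.
    have -> : s *: u - a *: x = a *: ((a^-1 * s) *: u - x).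
      by rewrite scalerBr scalerA mulrA a1 mul1r.
    by apply: Ksc (ltW a0) _; apply: xr; rewrite ltr_pdivlMl.
  have -> : a *: x - s *: u = a *: (x - (a^-1 * s) *: u).
    by rewrite scalerBr scalerA mulrA a1 mul1r.
  by apply: Ksc (ltW a0) _; apply: rx; rewrite ltr_pdivrMl.
have valZ a x r : val x r -> val (a *: x) (a * r).
  move=> xr; have [a0|a0|->] := ltgtP a 0; last by rewrite scale0r mul0r.
    rewrite -[a]opprK scaleNr mulNr; apply: valN; apply: valZp => //.
    by rewrite oppr_gt0.
  exact: valZp.
pose l : 'cV[R]_n := \col_i projT1 (cid (val_ex (delta_mx 0 i))).
have lP x : val x (lin l x).
  rewrite {1}(row_sum_delta x) /lin mxE.
  apply: (big_ind2 val) => [//|????|i _]; first exact: valD.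
  rewrite mxE; apply: valZ.
  by case: cid.
have valu : val u 1.
  split=> s s1; first by rewrite -{2}(scale1r u) -scalerBl; apply: Ksu; lra.
  by rewrite -{1}(scale1r u) -scalerBl; apply: Ksu; lra.
exists l.
  apply/eqP => l0; have := val_uniq _ _ _ valu (lP u).
  by rewrite /lin l0 mulmx0 mxE ler10.
move=> x Kx; rewrite leNgt; apply/negP => lx.
have [xl _] := lP x; apply: (nKu (lin l x / 2)); first by lra.
by rewrite -(subrK x (_ *: u)); apply: Kadd => //; apply: xl; lra.
Qed.

(** The functional [l] of the previous lemma decides membership outside its
    kernel, and the trace of [K] on the kernel is a total cone in smaller
    dimension. *)
Lemma total_cone_lex n (K : set 'rV[R]_n) : total_cone K ->
  exists ls, forall x, K x <-> lexpos ls x.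
Proof.
have [N] := ubnP n; elim: N => // N IH in n K * => nN tK.
have [[K0 Kadd Ksc] tot] := tK.
have [KT|/existsNP[x0 nK]] := pselect (forall x, K x); first by exists [::].
have [l l0 lK] := total_cone_functional tK nK.
(* The rows of [B] form a basis of the kernel of [l]. *)
pose B := row_base (kermx l).
have rl : (0 < \rank l)%N by rewrite lt0n mxrank_eq0.
have rk : (\rank (kermx l) < N)%N.
  rewrite mxrank_ker (leq_trans _ (nN : (n <= N)%N))// ltn_subrL rl /=.
  exact: leq_trans rl (rank_leq_row l).
have [|ls lsP] := IH _ [set y | K (y *m B)] rk.
  split; last by move=> x; rewrite /= mulNmx.
  split=> [|x y|a x]; rewrite /= ?mul0mx ?mulmxDl -?scalemxAl //.
    exact: Kadd.
  exact: Ksc.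
exists (l :: [seq pinvmx B *m l' | l' <- ls]) => x /=.
have lexM y : lexpos [seq pinvmx B *m l' | l' <- ls] y =
              lexpos ls (y *m pinvmx B).
  by elim: ls {lsP} => //= l' ls ->; rewrite /lin mulmxA.
have [lx|lx|lx] := ltgtP (lin l x) 0 => /=.
- by split=> // /lK; rewrite leNgt lx.
- split=> // _; case: (tot x) => // /lK; rewrite linN oppr_ge0.
  by rewrite leNgt lx.
- have xB : (x <= B)%MS.
    rewrite eq_row_base; apply/sub_kermxP.
    apply/matrixP => i j; rewrite !ord1 [RHS]mxE; exact: lx.
  by rewrite lexM -lsP /= mulmxKpV.
Qed.

End TotalCones.

(** * Antisymmetric orders and their total extensions *)

(** In a maximal pointed cone [K], a vector [x] with neither [x] nor [- x] in [K]
    could be adjoined: [c + a x = - (c' + a' x)] with [c], [c'] in [K] and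
    [a + a' > 0] would put [- x] in [K]. *)
Lemma pointed_cone_total_ext (R : realType) (n : nat) (C : set 'rV[R]_n) :
  is_cone C -> pointed C ->
  exists K, [/\ total_cone K, pointed K & C `<=` K].
Proof.
move=> cC pC.
(* Adding [C] to [A] lets the empty chain have an upper bound. *)
pose ext (A : set 'rV[R]_n) := is_cone (A `|` C) /\ pointed (A `|` C).
have [F Fext Ftot|A [[[K0 Kadd Ksc] pK] Amax]] := @Zorn_bigcup _ ext.
  pose G := \bigcup_(X in F) X.
  (* Any two elements of the union already lie in one member of the chain, or
     in [C] when the chain is empty. *)
  have two x y : (G `|` C) x -> (G `|` C) y -> exists A,
      [/\ ext A, (A `|` C) x, (A `|` C) y & A `<=` G].
    have ext0 : ext set0 by rewrite /ext set0U.
    move=> [[A FA Ax]|Cx] [[B FB By]|Cy].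
    - have [AB|BA] := Ftot _ _ FA FB.
        exists B; split; [exact: Fext|by left; apply: AB|by left|].
        exact: bigcup_sup.
      exists A; split; [exact: Fext|by left|by left; apply: BA|].
      exact: bigcup_sup.
    - exists A; split; [exact: Fext|by left|by right|exact: bigcup_sup].
    - exists B; split; [exact: Fext|by right|by left|exact: bigcup_sup].
    - by exists set0; split; [exact: ext0|right|right|].
  split; first split.
  - by right; case: cC.
  - move=> x y Gx Gy; have [A [[[_ Aadd _] _] Ax Ay AG]] := two x y Gx Gy.
    by have [/AG|] := Aadd _ _ Ax Ay; [left|right].
  - move=> a x a0 Gx; have [A [[[_ _ Asc] _] Ax _ AG]] := two x x Gx Gx.
    by have [/AG|] := Asc _ _ a0 Ax; [left|right].
  - move=> x Gx GNx; have [A [[_ pA] Ax ANx _]] := two _ _ Gx GNx.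
    exact: pA.
pose K := A `|` C; exists K; split=> //; last by move=> x; right.
split=> // x; apply: contrapT => /not_orP[nx nNx].
pose B := [set y | exists2 c, K c & exists2 a : R, 0 <= a & y = c + a *: x].
have KB : K `<=` B.
  by move=> y Ky; exists y => //; exists 0; rewrite // scale0r addr0.
have BC : B `|` C = B.
  by apply/setUidPl => y Cy; apply: KB; right.
apply: (Amax B).
  split; first by move=> y Ay; apply: KB; left.
  move=> /(_ x) Ax; apply: nx; left; apply: Ax.
  by exists 0 => //; exists 1; rewrite ?scale1r ?add0r.
rewrite /ext BC; split; first split.
- exact: KB.
- move=> _ _ [c Kc [a a0 ->]] [c' Kc' [a' a'0 ->]].
  exists (c + c'); first exact: Kadd.
  by exists (a + a'); [rewrite addr_ge0|rewrite scalerDl addrACA].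
- move=> b _ b0 [c Kc [a a0 ->]]; exists (b *: c); first exact: Ksc.
  by exists (b * a); [rewrite mulr_ge0|rewrite scalerDr scalerA].
- move=> y [c Kc [a a0 yE]] [c' Kc' [a' a'0 NyE]].
  have sum0 : (c + c') = - ((a + a') *: x).
    apply/eqP; rewrite -addr_eq0; apply/eqP.
    by rewrite scalerDl addrACA -yE -NyE subrr.
  have [aa0|aa0] := eqVneq (a + a') 0.
    have a00 : a = 0 by lra.
    have a'00 : a' = 0 by lra.
    have yc : y = c by rewrite yE a00 scale0r addr0.
    have yc' : - y = c' by rewrite NyE a'00 scale0r addr0.
    by apply: pK; [rewrite yc|rewrite yc'].
  have aap : 0 < a + a' by rewrite lt_neqAle eq_sym aa0 addr_ge0.
  case: nNx; have -> : - x = (a + a')^-1 *: (c + c').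
    by rewrite sum0 scalerN scalerA mulVf// scale1r.
  by apply: Ksc; [rewrite invr_ge0 ltW|exact: Kadd].
Qed.

(** * Finite-dimensional vector lattices *)

Section LatticeCones.
Variables (R : realType) (n : nat) (C : set 'rV[R]_n).

(** The positive part of [x] is its supremum with [0]. *)
Definition has_pos_part : Prop := forall x, exists p,
  [/\ C p, C (p - x) & forall q, C q -> C (q - x) -> C (q - p)].

Hypotheses (coneC : is_cone C) (pointC : pointed C) (posC : has_pos_part).

Local Notation "x <<= y" := (C (y - x)) (at level 70).

Let C0 : C 0.
Proof. by case: coneC. Qed.

Let Cadd x y : C x -> C y -> C (x + y).
Proof. by case: coneC => _ + _; exact. Qed.

Let Csc a x : 0 <= a -> C x -> C (a *: x).
Proof. by case: coneC => _ _; exact. Qed.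

Let le_tr y x z : x <<= y -> y <<= z -> x <<= z.
Proof. by move=> xy yz; rewrite -(subrK y z) -addrA; exact: Cadd. Qed.

Let leBl x y : C y -> x - y <<= x.
Proof. by rewrite opprB addrC subrK. Qed.

(** For positive [a] and [b] this is disjointness in the lattice sense, i.e. [0]
    is the infimum of [a] and [b]. *)
Definition disj (a b : 'rV[R]_n) : Prop :=
  forall c, c <<= a -> c <<= b -> C (- c).

Lemma disjC a b : disj a b -> disj b a.
Proof. by move=> ab c cb ca; exact: ab. Qed.

Lemma disj0 a : disj a 0.
Proof. by move=> c _; rewrite sub0r. Qed.

Lemma disj_self a : disj a a -> C a -> a = 0.
Proof. by move=> aa Ca; apply: pointC => //; apply: aa; rewrite subrr. Qed.

Lemma disj_le a b c : disj a b -> c <<= b -> disj a c.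
Proof. by move=> ab cb x xa xc; apply: ab => //; exact: le_tr cb. Qed.

(** If [x] is below [a] and [b + c], the positive part [p] of [x - b] is below [a]
    and [c], hence negative, and [x - p] is below [a] and [b], hence negative
    too. *)
Lemma disjD a b c : C a -> C b -> C c ->
  disj a b -> disj a c -> disj a (b + c).
Proof.
move=> Ca Cb Cc ab ac x xa xbc.
have [p [Cp xbp pmin]] := posC (x - b).
have pc : p <<= c by apply: pmin => //; rewrite opprB addrCA addrA.
have pa : p <<= a.
  by apply: pmin => //; rewrite opprB addrCA; exact: Cadd.
have xp : C (- (x - p)).
  apply: ab; first by apply: le_tr xa; exact: leBl.
  by rewrite opprB addrCA -opprB.
have -> : - x = - (x - p) + - p by rewrite opprB addrAC subrr sub0r.
by apply: Cadd => //; exact: ac.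
Qed.

Lemma disj_sum (I : Type) (s : seq I) (P : pred I) a f : C a ->
  (forall i, P i -> C (f i)) -> (forall i, P i -> disj a (f i)) ->
  disj a (\sum_(i <- s | P i) f i).
Proof.
move=> Ca Cf af; suff [] : C (\sum_(i <- s | P i) f i) /\
  disj a (\sum_(i <- s | P i) f i) by [].
elim/big_ind: _ => [|x y [Cx ax] [Cy ay]|i Pi].
- by split; [exact: C0|exact: disj0].
- by split; [exact: Cadd|exact: disjD].
- by split; [exact: Cf|exact: af].
Qed.

Lemma disjZ a b t : C a -> C b -> 0 <= t -> disj a b -> disj a (t *: b).
Proof.
move=> Ca Cb t0 ab; set m := Num.bound t.
(* [t *: b] is below an integer multiple of [b], which is a sum. *)
apply: (@disj_le _ (m%:R *: b)).
  rewrite scaler_nat -[m in _ *+ m]card_ord -sumr_const.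
  exact: disj_sum.
rewrite -scalerBl; apply: Csc => //.
by rewrite subr_ge0 ltW// archi_boundP.
Qed.

Definition disj_system (s : seq 'rV[R]_n) : Prop :=
  [/\ uniq s, forall e, e \in s -> C e /\ e != 0 &
      forall e f, e \in s -> f \in s -> e != f -> disj e f].

(** A linear relation between disjoint elements, with its positive and negative
    coefficients on either side of the equation, exhibits an element disjoint
    from itself. *)
Lemma disj_system_size s : disj_system s -> (size s <= n)%N.
Proof.
move=> [us Cs ds]; pose M := \matrix_(i < size s) s`_i.
have memM (i : 'I_(size s)) : s`_i \in s by exact: mem_nth.
have max0 (a : R) : 0 <= Num.max a 0 by rewrite le_max lexx orbT.
have Cmax (i : 'I_(size s)) a : C (Num.max a 0 *: s`_i).
  by apply: Csc => //; have [] := Cs _ (memM i).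
have le0 (u : 'rV[R]_(size s)) : u *m M = 0 -> forall i, u 0 i <= 0.
  move=> uM0 i.
  pose P := \sum_i (Num.max (u 0 i) 0) *: s`_i.
  pose N := \sum_i (Num.max (- u 0 i) 0) *: s`_i.
  have CP : C P by apply: cone_sum => // j _; exact: Cmax.
  have PN : P = N.
    apply/eqP; rewrite -subr_eq0 -sumrB; apply/eqP; rewrite -[RHS]uM0.
    rewrite mulmx_sum_row; apply: eq_bigr => j _; rewrite -scalerBl rowK.
    congr (_ *: _); have [u0|/ltW u0] := leP 0 (u 0 j).
      by rewrite max_r ?oppr_le0// subr0.
    by rewrite max_l ?oppr_ge0// sub0r opprK.
  have PN_disj : disj P N.
    apply: disj_sum => // j _; apply: disjC; apply: disj_sum => // k _.
    have [<-|jk] := eqVneq j k.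
      have [u0|/ltW u0] := leP 0 (u 0 j).
        rewrite max_r ?oppr_le0// scale0r.
        by apply: disjC; exact: disj0.
      by rewrite scale0r; exact: disj0.
    have [Cj _] := Cs _ (memM j); have [Ck _] := Cs _ (memM k).
    apply: disjZ => //.
    apply: disjC; apply: disjZ => //.
    by apply: ds => //; rewrite nth_uniq// eq_sym.
  have P0 : P = 0 by apply: disj_self => //; rewrite {2}PN.
  have [_ si0] := Cs _ (memM i).
  have: Num.max (u 0 i) 0 *: s`_i = 0.
    apply: pointC; first exact: Cmax.
    rewrite -sub0r -[X in X - _]P0 /P (bigD1 i)//= addrAC subrr add0r.
    by apply: cone_sum => // j _; exact: Cmax.
  move/eqP; rewrite scaler_eq0 (negPf si0) orbF => /eqP m0.
  by rewrite -m0 le_max lexx.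
suff /eqP <- : row_free M by exact: rank_leq_col.
apply: inj_row_free => u uM0; apply/rowP => i; rewrite mxE.
apply/eqP; rewrite eq_le le0//= -oppr_le0.
by have := le0 (- u); rewrite mulNmx uM0 oppr0 => /(_ erefl i); rewrite mxE.
Qed.

Lemma max_disj_system : exists2 s, disj_system s &
  forall s', disj_system s' -> (size s' <= size s)%N.
Proof.
pose has_size k := `[< exists2 s, disj_system s & size s = k >].
have ex0 : exists k, has_size k by exists 0%N; apply/asboolP; exists [::].
have bnd k : has_size k -> (k <= n)%N.
  by move=> /asboolP[s + <-]; exact: disj_system_size.
case: (ex_maxnP ex0 bnd) => k /asboolP[s sP sk] kmax.
by exists s => // s' s'P; rewrite sk; apply: kmax; apply/asboolP; exists s'.
Qed.

Definition chain_elt (e : 'rV[R]_n) : Prop :=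
  forall a b, C a -> C b -> a <<= e -> b <<= e -> a <<= b \/ b <<= a.

(** The vectors whose negative part is disjoint from [e]; [m] stands for any upper
    bound of the negative part, which avoids choosing it. *)
Definition polar_cone (e : 'rV[R]_n) : set 'rV[R]_n :=
  [set x | exists m, [/\ C m, C (x + m) & disj e m]].

Lemma pos_neg_disj x p : C p -> C (p - x) ->
  (forall q, C q -> C (q - x) -> C (q - p)) -> disj p (p - x).
Proof.
move=> Cp xp pmin c cp cx.
have -> : - c = (p - c) - p by rewrite addrAC subrr add0r.
by apply: pmin => //; rewrite addrAC.
Qed.

(** The positive part [p] and the negative part [p - x] of [x] are disjoint.  If
    neither were disjoint from [e], each would dominate a nonzero positive
    element below [e]; these two are comparable, so the smaller one would lie
    below both parts. *)
Lemma polar_cone_total e : C e -> chain_elt e -> total_cone (polar_cone e).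
Proof.
move=> Ce che; split; first split.
- by exists 0; rewrite addr0; split => //; exact: disj0.
- move=> x y [m [Cm Cxm em]] [q [Cq Cyq eq]]; exists (m + q).
  by split; [exact: Cadd|rewrite addrACA; exact: Cadd|exact: disjD].
- move=> a x a0 [m [Cm Cxm em]]; exists (a *: m).
  by split; [exact: Csc|rewrite -scalerDr; exact: Csc|exact: disjZ].
move=> x; have [p [Cp xp pmin]] := posC x.
have pn := pos_neg_disj Cp xp pmin.
have [en|nen] := pselect (disj e (p - x)).
  by left; exists (p - x); split=> //; rewrite addrC subrK.
have [ep|nep] := pselect (disj e p).
  by right; exists p; split=> //; rewrite addrC.
have below q : C q -> ~ disj e q ->
    exists c, [/\ C c, c != 0, c <<= e & c <<= q].
  move=> Cq /existsNP[c /not_implyP[ce /not_implyP[cq nc]]].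
  have [c' [Cc' cc' c'min]] := posC c; exists c'; split => //.
  - by apply/eqP => c'0; apply: nc; rewrite -sub0r -c'0.
  - exact: c'min.
  - exact: c'min.
have [c [Cc c0 ce cp]] := below _ Cp nep.
have [c' [Cc' c'0 c'e c'n]] := below _ xp nen.
have [cc'|c'c] := che _ _ Cc Cc' ce c'e.
  case/eqP: c0; apply: pointC => //; apply: pn => //.
  exact: le_tr c'n.
case/eqP: c'0; apply: pointC => //; apply: pn => //.
exact: le_tr cp.
Qed.

(** If [a] and [b] below [e] were not comparable, [e] could be replaced in the
    system by the positive and negative parts of [a - b], which are nonzero,
    disjoint and below [a] and [b]. *)
Lemma max_disj_system_chain s : disj_system s ->
  (forall s', disj_system s' -> (size s' <= size s)%N) ->
  forall e, e \in s -> chain_elt e.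
Proof.
move=> sP smax e es a b Ca Cb ae be; have [us Cs ds] := sP.
apply: contrapT => /not_orP[nab nba].
have [p [Cp abp pmin]] := posC (a - b); set q := p - (a - b).
have Cq : C q by [].
have pq : disj p q by exact: pos_neg_disj.
have pa : p <<= a by apply: pmin => //; rewrite opprB addrCA subrr addr0.
have qb : q <<= b.
  have -> : b - q = a - p by rewrite /q opprB addrA [b + _]addrC subrK.
  by [].
have p0 : p != 0.
  by apply/eqP => p0; apply: nab; move: abp; rewrite p0 sub0r opprB.
have q0 : q != 0.
  apply/eqP => /eqP; rewrite subr_eq0 => /eqP pE.
  by apply: nba; rewrite -pE.
have fe f : f \in rem e s -> [/\ f \in s, f != e & disj f e].
  rewrite (mem_rem_uniq _ us) inE => /andP[fne fs]; split => //.
  exact: ds.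
have nin r : C r -> r != 0 -> r <<= e -> r \notin rem e s.
  move=> Cr r0 re; apply/negP => /fe[_ _ rde].
  by case/eqP: r0; apply: disj_self => //; exact: disj_le re.
have pe : p <<= e by exact: le_tr ae.
have qe : q <<= e by exact: le_tr be.
have pNq : p != q.
  by apply: contra_neq p0 => pE; apply: disj_self => //; rewrite {2}pE.
have /smax : disj_system [:: p, q & rem e s].
  split=> [|f|].
  - by rewrite /= inE negb_or pNq !nin// rem_uniq.
  - by rewrite !inE => /or3P[/eqP->|/eqP->|/fe[/Cs]].
  have pf f : f \in rem e s -> disj p f /\ disj q f.
    by move=> /fe[_ _ fde]; split; apply: disjC; exact: disj_le fde _.
  move=> f g; rewrite !inE.
  move=> /or3P[/eqP->|/eqP->|fs] /or3P[/eqP->|/eqP->|gs] fg.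
  - by rewrite eqxx in fg.
  - exact: pq.
  - by have [] := pf _ gs.
  - exact: disjC.
  - by rewrite eqxx in fg.
  - by have [] := pf _ gs.
  - by apply: disjC; have [] := pf _ fs.
  - by apply: disjC; have [] := pf _ fs.
  - have [[fs' _ _] [gs' _ _]] := (fe _ fs, fe _ gs); exact: ds.
by rewrite /= size_rem//; case: (s) es => //= ? ? _; rewrite ltnn.
Qed.

(** If the negative part of [x] is disjoint from every member of a maximal system,
    it has to be [0], since otherwise it could be added to the system. *)
Lemma lattice_cone_lex : exists lss : seq (seq 'cV[R]_n),
  forall x, C x <-> all (fun ls => lexpos ls x) lss.
Proof.
have [s sP smax] := max_disj_system; have [us Cs ds] := sP.
have /choice[lf lfP] e : exists ls, e \in s ->
    forall x, polar_cone e x <-> lexpos ls x.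
  have [es|nes] := boolP (e \in s); last by exists [::].
  have [Ce _] := Cs _ es.
  have [ls lsP] := total_cone_lex
    (polar_cone_total Ce (max_disj_system_chain sP smax es)).
  by exists ls.
exists (map lf s) => x; rewrite all_map; split.
  move=> Cx; apply/allP => e es /=; apply/(lfP e es).
  by exists 0; rewrite addr0; split=> //; exact: disj0.
move=> /allP xs; have [p [Cp xp pmin]] := posC x; set m := p - x.
have me e : e \in s -> disj e m.
  move=> es; have /(lfP e es)[q [Cq Cxq eq]] := xs e es.
  apply: (disj_le eq).
  have -> : q - m = (x + q) - p by rewrite opprB addrCA addrA.
  by apply: pmin => //; rewrite addrAC subrr add0r.
have [m0|m0] := eqVneq m 0.
  by move/eqP: m0; rewrite subr_eq0 => /eqP <-.
have ms : m \notin s.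
  by apply/negP => /me mm; case/eqP: m0; exact: disj_self.
have /smax : disj_system (m :: s).
  split=> [|f|f g].
  - by rewrite /= ms.
  - by rewrite inE => /orP[/eqP->|/Cs].
  rewrite !inE => /orP[/eqP->|fs] /orP[/eqP->|gs] fg.
  - by rewrite eqxx in fg.
  - exact/disjC/me.
  - exact: me.
  - exact: ds.
by rewrite /= ltnn.
Qed.

End LatticeCones.

(** * Random vectors measurable for a sub-sigma-algebra *)

Section SubSigmaAlgebra.
Context {R : realType} {dO : measure_display} {Om : measurableType dO}.
Variable G : set (set Om).
Hypothesis sG : sigma_algebra setT G.

Local Notation OmG := (g_sigma_algebraType G).

(** Turns measurability for a sub-sigma-algebra into [measurable_fun] on an alias
    of [Om], where the library's closure lemmas apply. *)
Lemma sub_measurableP n (X : Om -> 'rV[R]_n) : sub_measurable G X <->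
  forall i, measurable_fun [set: OmG] (fun w : OmG => X w 0 i).
Proof.
have mG : (@measurable _ OmG) = G by exact: measurable_g_measurableTypeE.
split=> [mX i _ B mB|mX B mB].
  rewrite setTI mG; apply: (mX ((fun x : 'rV[R]_n => x 0 i) @^-1` B)).
  by apply: sub_sigma_algebra; exists i, B.
have [sG0 sGD sGU] := sG.
suff: @measurable _ (borel_rV R n) `<=` [set B | G (X @^-1` B)] by exact.
apply: smallest_sub.
  split; first by rewrite /= preimage_set0.
  - by move=> A GA; rewrite /= setTD preimage_setC -setTD; exact: sGD.
  - by move=> A GA; rewrite /= preimage_bigcup; exact: sGU.
move=> _ [i [C mC ->]]; rewrite /= -comp_preimage.
by have := mX i measurableT C mC; rewrite setTI mG.
Qed.

Lemma sub_measurable_cst n (c : 'rV[R]_n) : sub_measurable G (fun=> c).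
Proof. by apply/sub_measurableP => i; exact: measurable_cst. Qed.

Lemma sub_measurableB n (X Y : Om -> 'rV[R]_n) :
  sub_measurable G X -> sub_measurable G Y ->
  sub_measurable G (fun w => X w - Y w).
Proof.
move=> /sub_measurableP mX /sub_measurableP mY; apply/sub_measurableP => i.
rewrite (_ : (fun _ => _) = (fun w => X w 0 i) \- (fun w => Y w 0 i)).
  exact: measurable_funB.
by apply/funext => w; rewrite !mxE.
Qed.

Lemma lin_sub_measurable n (l : 'cV[R]_n) (X : Om -> 'rV[R]_n) :
  sub_measurable G X -> measurable_fun [set: OmG] (fun w : OmG => lin l (X w)).
Proof.
move=> /sub_measurableP mX.
rewrite (_ : (fun _ => _) = fun w => \sum_i X w 0 i * l i 0).
  apply: measurable_sum => i; exact: measurable_funM.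
by apply/funext => w; rewrite /lin mxE.
Qed.

Lemma lin_gt0_sub n (l : 'cV[R]_n) (X : Om -> 'rV[R]_n) :
  sub_measurable G X -> G [set w | 0 < lin l (X w)].
Proof.
move=> /(lin_sub_measurable l) mX.
have := mX measurableT `]0, +oo[%classic (measurable_itv _).
rewrite setTI measurable_g_measurableTypeE//; congr G.
by apply/seteqP; split => w /=; rewrite in_itv /= andbT.
Qed.

Lemma lin_eq0_sub n (l : 'cV[R]_n) (X : Om -> 'rV[R]_n) :
  sub_measurable G X -> G [set w | lin l (X w) = 0].
Proof.
move=> /(lin_sub_measurable l) mX.
have := mX measurableT [set 0] (measurable_set1 _).
by rewrite setTI measurable_g_measurableTypeE.
Qed.

Lemma lexpos_sub n (ls : seq 'cV[R]_n) (X : Om -> 'rV[R]_n) :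
  sub_measurable G X -> G [set w | lexpos ls (X w)].
Proof.
move=> mX.
have mG : (@measurable _ OmG) = G by exact: measurable_g_measurableTypeE.
elim: ls => [|l ls IH] /=; rewrite -mG.
  by rewrite (_ : [set _ | _] = setT)//; exact/seteqP.
rewrite (_ : [set _ | _] = [set w : OmG | 0 < lin l (X w)] `|`
    ([set w | lin l (X w) = 0] `&` [set w | lexpos ls (X w)])).
  apply: measurableU; first by rewrite mG; exact: lin_gt0_sub.
  by apply: measurableI; rewrite mG//; exact: lin_eq0_sub.
apply/seteqP; split => w /=.
  by move=> /orP[|/andP[/eqP]]; [left|right].
by move=> [->//|[/eqP -> ->]]; rewrite orbT.
Qed.

End SubSigmaAlgebra.

(** * Conditional expectations and lexicographic positivity *)

Section Integrals.
Context {R : realType} {dO : measure_display} {Om : measurableType dO}.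
Variable Q : probability Om R.

Lemma vintegrableB n (X Y : Om -> 'rV[R]_n) :
  vintegrable Q X -> vintegrable Q Y -> vintegrable Q (fun w => X w - Y w).
Proof.
move=> iX iY i; rewrite (_ : (fun _ => _) =
    (fun w => (X w 0 i)%:E - (Y w 0 i)%:E)%E); first exact: integrableB.
by apply/funext => w; rewrite !mxE.
Qed.

Lemma vintegrable_cst n (c : 'rV[R]_n) : vintegrable Q (fun=> c).
Proof. by move=> i; exact: finite_measure_integrable_cst. Qed.

Lemma lin_integrable n (l : 'cV[R]_n) (X : Om -> 'rV[R]_n) :
  vintegrable Q X -> Q.-integrable setT (fun w => (lin l (X w))%:E).
Proof.
move=> iX; rewrite (_ : (fun _ => _) =
    (fun w => \sum_i (l i 0)%:E * (X w 0 i)%:E)%E).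
  by apply: integrable_sum => // i _; exact: integrableZl.
apply/funext => w; rewrite /lin mxE -sumEFin; apply: eq_bigr => i _.
by rewrite mulrC EFinM.
Qed.

Lemma integral_lin n (l : 'cV[R]_n) (X : Om -> 'rV[R]_n) A : measurable A ->
  vintegrable Q X ->
  (\int[Q]_(w in A) (lin l (X w))%:E =
   \sum_i (l i 0)%:E * \int[Q]_(w in A) (X w 0 i)%:E)%E.
Proof.
move=> mA iX.
have iXA i : Q.-integrable A (fun w => (X w 0 i)%:E).
  exact: integrableS (iX i).
under eq_integral do rewrite /lin mxE -sumEFin.
rewrite integral_sum//; last first.
  by move=> i; under eq_fun do rewrite mulrC EFinM; exact: integrableZl.
apply: eq_bigr => i _; under eq_integral do rewrite mulrC EFinM.
exact: integralZl.
Qed.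

Lemma ae_ge0_integral_abs (D : set Om) (f : Om -> R) : measurable D ->
  Q.-integrable D (EFin \o f) -> {ae Q, forall w, D w -> 0 <= f w} ->
  (\int[Q]_(w in D) (f w)%:E = \int[Q]_(w in D) `|(f w)%:E|)%E.
Proof.
move=> mD iF f0; have mf := measurable_int _ iF.
apply: ae_eq_integral => //; first exact: measurableT_comp.
by apply: filterS f0 => w f0 Dw; rewrite /= ger0_norm ?f0.
Qed.

Lemma ae_ge0_integral_eq0 (D : set Om) (f : Om -> R) : measurable D ->
  Q.-integrable D (EFin \o f) -> {ae Q, forall w, D w -> 0 <= f w} ->
  (\int[Q]_(w in D) (f w)%:E <= 0)%E -> {ae Q, forall w, D w -> f w = 0}.
Proof.
move=> mD iF f0 int0; have mf := measurable_int _ iF.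
have: (\int[Q]_(w in D) `|(f w)%:E|)%E = 0.
  apply/eqP; rewrite eq_le -{1}ae_ge0_integral_abs// int0/=.
  exact: integral_ge0.
move/(ae_eq_integral_abs Q mD mf).
by apply: filterS => w + Dw => /(_ Dw) [].
Qed.

Variable G : set (set Om).
Hypotheses (sG : sigma_algebra setT G) (mG : G `<=` measurable).

Lemma cond_exp_integral_lin n (l : 'cV[R]_n) (X Y : Om -> 'rV[R]_n) A :
  is_cond_exp Q G X Y -> G A ->
  (\int[Q]_(w in A) (lin l (Y w))%:E = \int[Q]_(w in A) (lin l (X w))%:E)%E.
Proof.
move=> [iX mY iY XY] GA; rewrite !integral_lin//; try exact: mG.
by apply: eq_bigr => i _; rewrite XY.
Qed.

Let GI A B : G A -> G B -> G (A `&` B).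
Proof.
move=> GA GB; rewrite -(measurable_g_measurableTypeE sG).
by apply: measurableI; rewrite measurable_g_measurableTypeE.
Qed.

(** The induction on the list of functionals restricts to the event where the
    first one vanishes on [Y]; this is why the statement is relative to an event
    [A] of [G]. *)
Lemma cond_exp_lexpos n (ls : seq 'cV[R]_n) (X Y : Om -> 'rV[R]_n) A :
  is_cond_exp Q G X Y -> G A -> {ae Q, forall w, A w -> lexpos ls (X w)} ->
  {ae Q, forall w, A w -> lexpos ls (Y w)}.
Proof.
move=> XY; elim: ls A => [|l ls IH] A GA XA; first exact: aeW.
have [iX mY iY _] := XY.
have lX0 : {ae Q, forall w, A w -> 0 <= lin l (X w)}.
  apply: filterS XA => w + Aw => /(_ Aw) /= /orP[/ltW//|/andP[/eqP->]//].
have ilX D : measurable D -> Q.-integrable D (EFin \o (fun w => lin l (X w))).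
  by move=> mD; apply: integrableS (lin_integrable l iX).
have ilY D : measurable D -> Q.-integrable D (EFin \o (fun w => lin l (Y w))).
  by move=> mD; apply: integrableS (lin_integrable l iY).
have intXY D := @cond_exp_integral_lin n l X Y D XY.
(* On [B], [- l Y] is positive with integral [- \int_B l X <= 0]. *)
pose B := A `&` [set w | 0 < lin (- l) (Y w)].
have GB : G B by apply: GI => //; exact: lin_gt0_sub.
have linNl x : lin (- l) x = - lin l x by rewrite /lin mulmxN mxE.
have lY0 : {ae Q, forall w, A w -> 0 <= lin l (Y w)}.
  have iNY : Q.-integrable B (EFin \o (fun w => - lin l (Y w))).
    rewrite (_ : _ \o _ = (-%E \o (EFin \o (fun w => lin l (Y w))))%E)//.
    by apply: integrableN; apply: ilY; exact: mG.
  have: {ae Q, forall w, B w -> - lin l (Y w) = 0}.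
    apply: (ae_ge0_integral_eq0 _ iNY) => //; first exact: mG.
      by apply: aeW => w [_] /=; rewrite linNl => /ltW.
    under eq_integral do rewrite EFinN.
    rewrite integralN; last first.
      exact: (integrable_add_def (mG GB) (ilY _ (mG GB))).
    rewrite oppe_le0 intXY// ae_ge0_integral_abs//; try exact: mG.
    - exact: integral_ge0.
    - by apply: ilX; exact: mG.
    - by apply: filterS lX0 => w + [Aw _]; exact.
  apply: filterS => w Bw Aw; rewrite leNgt; apply/negP => lYw.
  have := Bw; rewrite /B /= linNl oppr_gt0 => /(_ (conj Aw lYw)) /eqP.
  by rewrite oppr_eq0 lt_eqF.
pose A' := A `&` [set w | lin l (Y w) = 0].
have GA' : G A' by apply: GI => //; exact: lin_eq0_sub.
have lXA' : {ae Q, forall w, A' w -> lin l (X w) = 0}.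
  apply: ae_ge0_integral_eq0; [exact: mG|apply: ilX; exact: mG| |].
    by apply: filterS lX0 => w + [Aw _]; exact.
  rewrite -intXY// (@integral0_eq _ _ _ _ _ (fun w => (lin l (Y w))%:E))//.
  by move=> w [_ /= ->].
have /(IH _ GA') YA' : {ae Q, forall w, A' w -> lexpos ls (X w)}.
  apply: filterS2 XA lXA' => w Xw lXw A'w; have [Aw _] := A'w.
  by move: (Xw Aw); rewrite /= lXw// ltxx eqxx.
apply: filterS2 lY0 YA' => w lYw Yw Aw /=.
have := lYw Aw; rewrite le_eqVlt => /orP[/eqP lY|-> //].
by rewrite -lY eqxx Yw ?orbT//; split.
Qed.

Lemma cond_exp_ae_eq n (X X' Y : Om -> 'rV[R]_n) :
  vintegrable Q X' -> {ae Q, forall w, X w = X' w} ->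
  is_cond_exp Q G X Y -> is_cond_exp Q G X' Y.
Proof.
move=> iX' XX' [iX mY iY XY]; split=> // A GA i; rewrite XY//.
have mA := mG GA.
apply: ae_eq_integral => //.
- exact: measurable_int (integrableS _ _ _ (iX i)).
- exact: measurable_int (integrableS _ _ _ (iX' i)).
- by apply: filterS XX' => w /= -> _.
Qed.

Lemma cond_expB n (X X' Y Y' : Om -> 'rV[R]_n) :
  is_cond_exp Q G X Y -> is_cond_exp Q G X' Y' ->
  is_cond_exp Q G (fun w => X w - X' w) (fun w => Y w - Y' w).
Proof.
move=> [iX mY iY XY] [iX' mY' iY' XY']; split.
- exact: vintegrableB.
- exact: sub_measurableB.
- exact: vintegrableB.
move=> A GA i; have mA := mG GA.
have iA Z : vintegrable Q Z -> Q.-integrable A (fun w => (Z w 0 i)%:E).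
  by move=> iZ; apply: integrableS (iZ i).
under eq_integral do rewrite !mxE EFinB.
under [RHS]eq_integral do rewrite !mxE EFinB.
by rewrite !integralB//; [rewrite XY// XY'|exact: iA..].
Qed.

End Integrals.

(** * Almost sure constancy *)

Section AlmostSureConstancy.
Context {R : realType} {dO : measure_display} {Om : measurableType dO}.
Variable P : probability Om R.

Lemma ae_ex (A : set Om) : {ae P, forall w, A w} -> exists w, A w.
Proof.
have P1 : (0 < P setT)%E by rewrite probability_setT lte01.
have pP := ae_properfilter_algebraOfSetsType P1.
by move=> aeA; have [w Aw] := filter_ex aeA; exists w.
Qed.

(** Such an [f] is at least its mean [m]: [m <= f w0] for almost every [w0].  Then
    [f - m] is nonnegative with zero integral. *)
Lemma ae_le_own_values_cst (f : Om -> R) (G : set Om) :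
  P.-integrable setT (EFin \o f) -> {ae P, forall w, G w} ->
  (forall w0, G w0 -> {ae P, forall w, f w <= f w0}) ->
  exists c, {ae P, forall w, f w = c}.
Proof.
move=> iF aeG fG; pose m := fine (\int[P]_w (f w)%:E).
have mE : (\int[P]_w (f w)%:E = m%:E)%E by rewrite fineK// integrable_fin_num.
have icst (c : R) : P.-integrable setT (EFin \o fun=> c).
  exact: finite_measure_integrable_cst.
have int_cst (c : R) : (\int[P]_(w in setT) (EFin \o fun=> c) w = c%:E)%E.
  by rewrite integral_cst//= probability_setT mule1.
have aem : {ae P, forall w, 0 <= f w - m}.
  apply: filterS aeG => w0 /fG fw0.
  have iG : P.-integrable setT (EFin \o (fun w => f w0 - f w)).
    rewrite (_ : _ \o _ = fun w => ((EFin \o fun=> f w0) w - (f w)%:E)%E)//.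
    exact: integrableB.
  have := @ae_ge0_integral_abs _ _ _ P setT _ measurableT iG.
  have -> : (\int[P]_(w in setT) (f w0 - f w)%:E = (f w0 - m)%:E)%E.
    under eq_integral do rewrite EFinB.
    by rewrite (integralB _ (icst (f w0)) iF)// int_cst /= mE.
  move=> intE; have: (0 <= (f w0 - m)%:E)%E.
    rewrite intE; first exact: integral_ge0.
    by apply: filterS fw0 => w fw _; rewrite subr_ge0.
  by rewrite lee_fin.
exists m.
have iFm : P.-integrable setT (EFin \o (fun w => f w - m)).
  rewrite (_ : _ \o _ = fun w => ((f w)%:E - (EFin \o fun=> m) w)%E)//.
  exact: integrableB.
have := @ae_ge0_integral_eq0 _ _ _ P setT _ measurableT iFm.
have -> : (\int[P]_(w in setT) (f w - m)%:E = 0)%E.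
  under eq_integral do rewrite EFinB.
  by rewrite (integralB _ iF (icst m))// int_cst /= mE subee.
move=> /(_ _ (lexx 0%E)) fm0.
have /fm0 : {ae P, forall w, setT w -> 0 <= f w - m} by apply: filterS aem.
by apply: filterS => w /(_ I) /eqP; rewrite subr_eq0 => /eqP.
Qed.

Lemma ae_lex_own_values_cst n (ls : seq 'cV[R]_n) (V : Om -> 'rV[R]_n) G :
  vintegrable P V -> {ae P, forall w, G w} ->
  (forall w0, G w0 -> {ae P, forall w, lexpos ls (V w0 - V w)}) ->
  exists2 H : set Om, {ae P, forall w, H w} &
    forall w0 w1, H w0 -> H w1 -> lexpos ls (V w0 - V w1).
Proof.
move=> iV; elim: ls G => [|l ls IH] G aeG VG; first by exists G.
have [w0 Gw0|c fc] := ae_le_own_values_cst (lin_integrable l iV) aeG.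
  apply: filterS (VG _ Gw0) => w /= /orP[|/andP[/eqP + _]]; rewrite linB.
    by rewrite subr_gt0 => /ltW.
  by move/eqP; rewrite subr_eq0 => /eqP ->.
pose G' := G `&` [set w | lin l (V w) = c].
have [||H aeH HV] := IH G'.
- by apply: filterS2 aeG fc => w.
- move=> w0 [Gw0 fw0]; apply: filterS2 fc (VG _ Gw0) => w fw /=.
  by rewrite linB fw0 fw subrr ltxx eqxx.
exists (H `&` [set w | lin l (V w) = c]).
  by apply: filterS2 aeH fc => w.
move=> w0 w1 [Hw0 /= fw0] [Hw1 /= fw1].
by rewrite linB fw0 fw1 subrr eqxx HV ?orbT.
Qed.

(** Any total order extending the given one inherits the hypothesis, and is
    lexicographic, so that the functionals defining it are almost surely constant
    along [V], one after the other. *)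
Lemma ae_cone_own_values_cst n (C : set 'rV[R]_n) (V : Om -> 'rV[R]_n) G :
  is_cone C -> pointed C -> vintegrable P V -> {ae P, forall w, G w} ->
  (forall w0, G w0 -> {ae P, forall w, C (V w0 - V w)}) ->
  exists c, {ae P, forall w, V w = c}.
Proof.
move=> cC pC iV aeG VG.
have [K [tK pK CK]] := pointed_cone_total_ext cC pC.
have [ls lsP] := total_cone_lex tK.
have [w0 /VG|H aeH HV] := @ae_lex_own_values_cst n ls V G iV aeG.
  by apply: filterS => w /CK /lsP.
have [w0 Hw0] := ae_ex aeH.
exists (V w0); apply: filterS aeH => w Hw; apply/eqP.
rewrite -subr_eq0; apply/eqP; apply: pK; first by apply/lsP; exact: HV.
by rewrite opprB; apply/lsP; exact: HV.
Qed.

End AlmostSureConstancy.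

(** * Conditional expectations and suprema in the robust model *)

Section Model.
Context {R : realType} {dO : measure_display} {Om : measurableType dO}.
Variables (P : probability Om R) (T : nat) (Fil : nat -> set (set Om)).
Hypothesis hFil : filtration T Fil.
Variables (d : nat) (Theta : set 'rV[R]_d) (Q : 'rV[R]_d -> probability Om R).
Hypothesis Q_ac : forall theta, Theta theta -> Q theta `<< P.
Hypothesis hE : cexp_well_defined P T Fil Theta Q.
Variable prec : 'rV[R]_d -> 'rV[R]_d -> Prop.
Hypotheses (hprec : vector_preorder prec) (hanti : vantisymmetric prec).

Local Notation L t := (L1 P (Fil t) (n := d)).
Local Notation C := (ordering_cone prec).
Local Notation cE := (cexp P Fil Q).
Local Notation vS := (vsup P Fil Theta prec).

Let sFil t : (t <= T)%N -> sigma_algebra setT (Fil t).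
Proof. by case: hFil => + _ _; exact. Qed.

Let mFil t : (t <= T)%N -> Fil t `<=` measurable.
Proof. by case: hFil => _ + _; exact. Qed.

Lemma L_le s t : (s <= t)%N -> (t <= T)%N -> L s `<=` L t.
Proof.
move=> st tT X [mX iX]; split=> // B mB.
by case: hFil => _ _ /(_ s t st tT); apply; exact: mX.
Qed.

Lemma LB t X Y : (t <= T)%N -> L t X -> L t Y -> L t (fun w => X w - Y w).
Proof.
move=> tT [mX iX] [mY iY]; split; last exact: vintegrableB.
exact: (sub_measurableB (sFil tT)).
Qed.

Lemma L_cst t c : (t <= T)%N -> L t (fun=> c).
Proof.
move=> tT; split; last exact: vintegrable_cst.
exact: (sub_measurable_cst (sFil tT)).
Qed.

Lemma as_eq_sym n (X Y : Om -> 'rV[R]_n) : as_eq P X Y -> as_eq P Y X.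
Proof. by apply: filterS => w ->. Qed.

Lemma as_eq_trans n (X Y Z : Om -> 'rV[R]_n) :
  as_eq P X Y -> as_eq P Y Z -> as_eq P X Z.
Proof. by apply: filterS2 => w -> ->. Qed.

Lemma as_eq_refl n (X : Om -> 'rV[R]_n) : as_eq P X X.
Proof. exact: aeW. Qed.

Lemma ordering_cone_cone : is_cone C.
Proof.
case: hprec => prefl ptrans padd pscale; split=> [|x y Cx Cy|a x a0 Cx].
- exact: prefl.
- rewrite /ordering_cone /=; apply: ptrans Cy _.
  by have := padd _ _ y Cx; rewrite add0r.
- by have := pscale _ _ _ a0 Cx; rewrite scaler0.
Qed.

Lemma ordering_cone_pointed : pointed C.
Proof.
case: hprec => _ _ padd _ x Cx CNx; apply: hanti => //.
by have := padd _ _ x CNx; rewrite add0r addNr.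
Qed.

Let coneC := ordering_cone_cone.
Let pointC := ordering_cone_pointed.

Lemma prec_tP t X Y : (t <= T)%N -> L t X -> L t Y ->
  {ae P, forall w, C (Y w - X w)} -> prec_t P Fil prec t X Y.
Proof. by move=> tT LX LY XY; split=> //; exact: LB. Qed.

Lemma prec_t_anti t X Y : prec_t P Fil prec t X Y -> prec_t P Fil prec t Y X ->
  as_eq P X Y.
Proof.
move=> [_ XY] [_ YX]; apply: filterS2 XY YX => w XY YX; apply/eqP.
by rewrite -subr_eq0; apply/eqP; apply: pointC => //; rewrite opprB.
Qed.

Lemma prec_t_trans t X Y Z : (t <= T)%N -> L t X -> L t Z ->
  prec_t P Fil prec t X Y -> prec_t P Fil prec t Y Z ->
  prec_t P Fil prec t X Z.
Proof.
move=> tT LX LZ [_ XY] [_ YZ]; apply: prec_tP => //.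
apply: filterS2 XY YZ => w XY YZ; rewrite -(subrK (Y w) (Z w)) -addrA.
by case: coneC => _ + _; exact.
Qed.

Lemma prec_t_as_eq t X Y : (t <= T)%N -> L t X -> L t Y -> as_eq P X Y ->
  prec_t P Fil prec t X Y.
Proof.
move=> tT LX LY XY; apply: prec_tP => //; apply: filterS XY => w ->.
by rewrite subrr; case: coneC.
Qed.

Let Q_ae theta (A : set Om) : Theta theta ->
  {ae P, forall w, A w} -> {ae Q theta, forall w, A w}.
Proof.
move=> Th [N [mN PN AN]]; exists N; split=> //.
by apply: (null_content_dominatesP _ _).1 PN => //; exact: Q_ac.
Qed.

Lemma cexp_is_cexp theta s t X : Theta theta -> (t <= s)%N -> (s <= T)%N ->
  L s X -> is_cexp P Fil Q theta t X (cE theta t X).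
Proof. by move=> Th ts sT LX; apply: xgetPex; exact: (hE Th ts sT LX).1. Qed.

Lemma cexp_L theta s t X : Theta theta -> (t <= s)%N -> (s <= T)%N ->
  L s X -> L t (cE theta t X).
Proof. by move=> Th ts sT LX; have [] := cexp_is_cexp Th ts sT LX. Qed.

Lemma cexp_unique theta s t X Y : Theta theta -> (t <= s)%N -> (s <= T)%N ->
  L s X -> is_cexp P Fil Q theta t X Y -> as_eq P (cE theta t X) Y.
Proof.
by move=> Th ts sT LX; apply: (hE Th ts sT LX).2; exact: cexp_is_cexp LX.
Qed.

Lemma L_vintegrable theta s X : Theta theta -> (s <= T)%N -> L s X ->
  vintegrable (Q theta) X.
Proof. by move=> Th sT LX; have [[Y [_ []]]] := hE Th (leqnn s) sT LX. Qed.

Lemma cexp_as_eq theta s t X X' : Theta theta -> (t <= s)%N -> (s <= T)%N ->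
  L s X -> L s X' -> as_eq P X X' -> as_eq P (cE theta t X) (cE theta t X').
Proof.
move=> Th ts sT LX LX' XX'; apply: as_eq_sym.
apply: (cexp_unique Th ts sT LX').
have [LY XY] := cexp_is_cexp Th ts sT LX; split=> //.
apply: cond_exp_ae_eq XY; [exact: mFil (leq_trans ts sT)| |exact: Q_ae].
exact: L_vintegrable LX'.
Qed.

Lemma cexpB theta s t X X' : Theta theta -> (t <= s)%N -> (s <= T)%N ->
  L s X -> L s X' ->
  as_eq P (cE theta t (fun w => X w - X' w))
    (fun w => cE theta t X w - cE theta t X' w).
Proof.
move=> Th ts sT LX LX'; have tT := leq_trans ts sT.
apply: (@cexp_unique theta s) => //; first exact: LB.
have [LY XY] := cexp_is_cexp Th ts sT LX.
have [LY' XY'] := cexp_is_cexp Th ts sT LX'.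
split; first exact: LB.
by apply: cond_expB => //; [exact: sFil|exact: mFil].
Qed.

Lemma cexp_tower theta s t u X : Theta theta -> (t <= s)%N -> (s <= u)%N ->
  (u <= T)%N -> L u X ->
  as_eq P (cE theta t X) (cE theta t (cE theta s X)).
Proof.
move=> Th ts su uT LX; have sT := leq_trans su uT.
have [LY [iX mY iY XY]] := cexp_is_cexp Th su uT LX.
have [LZ [_ mZ iZ YZ]] := cexp_is_cexp Th ts sT LY.
apply: (cexp_unique Th (leq_trans ts su) uT LX); split=> //; split=> // A tA i.
by rewrite YZ// XY//; case: hFil => _ _ /(_ t s ts sT); exact.
Qed.

(** If [N] were null for the model only, then [0] and the random vector equal to
    [(1, ..., 1)] on [N] and [0] elsewhere would be two versions of the
    conditional expectation of [0] that differ on a set of positive reference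
    measure. *)
Lemma cexp_null theta t N : Theta theta -> (t <= T)%N -> (0 < d)%N ->
  Fil t N -> Q theta N = 0%E -> P N = 0%E.
Proof.
move=> Th tT d0 FN QN; have mN := mFil tT FN.
pose Y w : 'rV[R]_d := const_mx (\1_N w).
have LY : L t Y.
  split; last first.
    by move=> i; under eq_fun do rewrite mxE; exact: integrable_indic.
  apply/(sub_measurableP (sFil tT)) => i; under eq_fun do rewrite mxE.
  apply: measurable_indic.
  by rewrite measurable_g_measurableTypeE//; exact: sFil.
have L0 := L_cst 0 tT.
have iL X := @L_vintegrable theta t X Th tT.
have ae0 : {ae Q theta, forall w, Y w = 0}.
  exists N; split=> // w /=; apply: contra_notP => Nw.
  by apply/rowP => i; rewrite !mxE indicE memNset.
have cE0 : is_cexp P Fil Q theta t (fun=> 0) (fun=> 0).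
  by split=> //; split=> //; [exact: iL|case: L0|exact: iL].
have cEY : is_cexp P Fil Q theta t (fun=> 0) Y.
  split=> //; apply: (cond_exp_ae_eq (mFil tT) (iL _ L0) ae0).
  by split=> //; [exact: iL|case: LY|exact: iL].
have Y0 := (hE Th (leqnn t) tT L0).2 _ _ cEY cE0.
apply/(negligibleP _ mN); apply: negligibleS Y0 => w Nw /= Yw0.
have := congr1 (fun y : 'rV[R]_d => y 0 (Ordinal d0)) Yw0.
by rewrite !mxE indicE mem_set// => /eqP; rewrite oner_eq0.
Qed.

Hypothesis hsup : finite_sups P T Fil Theta prec.

Lemma vsupP t X : (t <= T)%N -> (forall theta, Theta theta -> L t (X theta)) ->
  is_vsup P Fil Theta prec t X (vS t X).
Proof. by move=> tT LX; apply: xgetPex; exact: hsup. Qed.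

Lemma vsup_as_eq t X X' : (t <= T)%N ->
  (forall theta, Theta theta -> L t (X theta)) ->
  (forall theta, Theta theta -> L t (X' theta)) ->
  (forall theta, Theta theta -> as_eq P (X theta) (X' theta)) ->
  as_eq P (vS t X) (vS t X').
Proof.
move=> tT; have le Y Y' : (forall theta, Theta theta -> L t (Y theta)) ->
    (forall theta, Theta theta -> L t (Y' theta)) ->
    (forall theta, Theta theta -> as_eq P (Y theta) (Y' theta)) ->
    prec_t P Fil prec t (vS t Y) (vS t Y').
  move=> LY LY' YY'; have [_ _] := vsupP tT LY; apply.
    by have [] := vsupP tT LY'.
  move=> theta Th; have [LV Y'V _] := vsupP tT LY'.
  apply: prec_t_trans (Y'V _ Th) => //; first exact: LY.
  by apply: prec_t_as_eq; [|exact: LY|exact: LY'|exact: YY'].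
move=> LX LX' XX'; apply: (@prec_t_anti t); first exact: le.
by apply: le => // theta Th; apply: as_eq_sym; exact: XX'.
Qed.

(** The supremum of the constants [x] and [0] is a random vector [V] a priori.
    Almost every value of [V] is an upper bound of [x] and [0], hence, as a
    constant, an upper bound of [V]: so [V] is almost surely constant. *)
Lemma models_pos_part theta1 theta2 : Theta theta1 -> Theta theta2 ->
  theta1 != theta2 -> has_pos_part C.
Proof.
move=> Th1 Th2 th12 x.
pose X (theta : 'rV[R]_d) : Om -> 'rV[R]_d :=
  fun=> if theta == theta1 then x else 0.
have LX theta : Theta theta -> L 0%N (X theta) by move=> _; exact: L_cst.
have [V [LV XV Vmin]] := hsup (leq0n T) LX.
have [_ xV] := XV _ Th1; have [_ zV] := XV _ Th2.
rewrite /X eqxx in xV; rewrite /X eq_sym (negPf th12) in zV.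
pose G := [set w | C (V w - x) /\ C (V w - 0)].
have aeG : {ae P, forall w, G w} by apply: filterS2 xV zV => w.
have below q : C (q - x) -> C (q - 0) -> {ae P, forall w, C (q - V w)}.
  move=> qx q0; have [|//] := Vmin (fun=> q) (L_cst _ (leq0n T)).
  move=> theta Th; apply: prec_tP => //; [exact: LX|exact: L_cst|].
  by apply: aeW => w; rewrite /X; case: ifP.
have [|p Vp] := ae_cone_own_values_cst coneC pointC LV.2 aeG.
  by move=> w0 [? ?]; exact: below.
have [w [[xVw zVw] Vw]] : exists w, G w /\ V w = p.
  by apply: ae_ex; apply: filterS2 aeG Vp.
rewrite Vw subr0 in xVw zVw; exists p; split=> // q Cq xq.
have [|w1 [qw Vw1]] := @ae_ex _ _ _ P [set w | C (q - V w) /\ V w = p].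
  by apply: filterS2 (below q xq _) Vp => //; rewrite subr0.
by rewrite -Vw1.
Qed.

(** The exceptional event for each lexicographic list is in [Fil t], which allows
    passing from the model to the reference measure. *)
Lemma cexp_cone theta s t X : has_pos_part C -> Theta theta ->
  (t <= s)%N -> (s <= T)%N -> L s X -> {ae P, forall w, C (X w)} ->
  {ae P, forall w, C (cE theta t X w)}.
Proof.
move=> posC Th ts sT LX CX; have tT := leq_trans ts sT.
(* In dimension [0] a null set of the model need not be null for [P]. *)
have [d0|d0] := posnP d.
  apply: aeW => w; rewrite (_ : cE theta t X w = 0); first by case: coneC.
  by apply/rowP => i; have := ltn_ord i; rewrite {2}d0.
have [lss lssP] := lattice_cone_lex coneC pointC posC.
suff : {ae P, forall w, all (fun ls => lexpos ls (cE theta t X w)) lss}.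
  by apply: filterS => w /lssP.
have {CX} : {ae P, forall w, all (fun ls => lexpos ls (X w)) lss}.
  by apply: filterS CX => w /lssP.
elim: lss {lssP} => [_|ls lss IH aeX]; first exact: aeW.
have aels : {ae P, forall w, lexpos ls (X w)}.
  by apply: filterS aeX => w /andP[].
have /IH aelss : {ae P, forall w, all (fun ls => lexpos ls (X w)) lss}.
  by apply: filterS aeX => w /andP[].
have [LY XY] := cexp_is_cexp Th ts sT LX.
have FT : Fil t setT.
  by rewrite -(measurable_g_measurableTypeE (sFil tT)); exact: measurableT.
have Qls : {ae Q theta, forall w, lexpos ls (cE theta t X w)}.
  have : {ae Q theta, forall w, setT w -> lexpos ls (X w)}.
    by apply: filterS (Q_ae Th aels).
  move/(cond_exp_lexpos (sFil tT) (mFil tT) XY FT).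
  by apply: filterS => w; exact.
pose N := ~` [set w | lexpos ls (cE theta t X w)].
have FN : Fil t N.
  rewrite -(measurable_g_measurableTypeE (sFil tT)); apply: measurableC.
  rewrite measurable_g_measurableTypeE; last exact: sFil.
  by apply: lexpos_sub; [exact: sFil|case: LY].
have mN := mFil tT FN.
have QN : Q theta N = 0%E by exact/(negligibleP _ mN).
have PN : {ae P, forall w, lexpos ls (cE theta t X w)}.
  exact/(negligibleP _ mN)/(cexp_null Th tT d0 FN QN).
by apply: filterS2 PN aelss => w /= -> ->.
Qed.

(** With two models the cone is preserved by conditional expectations.  With a
    single one it need not be a lattice cone, but then the inner supremum is
    almost surely equal to the conditional expectation itself. *)
Lemma cexp_le_vsup theta t X : Theta theta -> (t < T)%N -> L T X ->
  prec_t P Fil prec t (cE theta t X)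
    (cE theta t (vS t.+1 (fun theta' => cE theta' t.+1 X))).
Proof.
move=> Th tT LX; set W := vS _ _.
have LcX theta' : Theta theta' -> L t.+1 (cE theta' t.+1 X).
  by move=> Th'; exact: cexp_L LX.
have [LW XW Wmin] : is_vsup P Fil Theta prec t.+1
    (fun theta' => cE theta' t.+1 X) W by exact: vsupP.
have LX1 := LcX _ Th.
have tower := cexp_tower Th (leqnSn t) tT (leqnn T) LX.
have LE Y : L t.+1 Y -> L t (cE theta t Y) by exact: cexp_L.
have LcEX : L t (cE theta t X) := cexp_L Th (ltnW tT) (leqnn T) LX.
have [[theta' [Th' th]]|one] :=
    pselect (exists theta', Theta theta' /\ theta' != theta).
  have posC := models_pos_part Th' Th th.
  apply: prec_tP; [exact: ltnW|exact: LcEX|exact: LE|].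
  have CWX : {ae P, forall w,
      C (cE theta t (fun w => W w - cE theta t.+1 X w) w)}.
    apply: (cexp_cone posC Th (leqnSn t) tT); first exact: LB.
    by have [] := XW _ Th.
  have := cexpB Th (leqnSn t) tT LW LX1.
  apply: filterS3 CWX tower => w CWX -> <-; exact: CWX.
apply: prec_t_as_eq; [exact: ltnW|exact: LcEX|exact: LE|].
apply: as_eq_trans tower _; apply: (cexp_as_eq Th (leqnSn t) tT LX1 LW).
apply: (@prec_t_anti t.+1); first exact: XW.
apply: Wmin => // theta' Th'.
have -> : theta' = theta.
  by apply/eqP; apply: contra_notT one => th; exists theta'.
by apply: prec_t_as_eq => //; exact: as_eq_refl.
Qed.

Hypothesis hrect : rectangular P T Fil Theta Q prec.

Lemma robust_tower t X : (t < T)%N -> L T X ->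
  as_eq P (vS t (fun theta => cE theta t X))
    (vS t (fun theta => cE theta t
       (vS t.+1 (fun theta' => cE theta' t.+1 X)))).
Proof.
move=> tT LX; have tT' := ltnW tT; set W := vS t.+1 _.
have LW : L t.+1 W.
  have [] // := @vsupP t.+1 (fun theta' => cE theta' t.+1 X) tT.
  by move=> theta Th; exact: cexp_L LX.
have LcX theta : Theta theta -> L t (cE theta t X).
  by move=> Th; exact: (cexp_L Th tT' (leqnn T) LX).
have LcW theta : Theta theta -> L t (cE theta t W).
  by move=> Th; exact: (cexp_L Th (leqnSn t) tT LW).
apply: (@prec_t_anti t); last exact: hrect.
have [LV WV _] := vsupP tT' LcW.
have [_ _] := vsupP tT' LcX; apply=> // theta Th.
apply: prec_t_trans (WV _ Th) => //; first exact: LcX.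
exact: cexp_le_vsup.
Qed.

(** * Dynamic programming *)

Section Control.
Context {m k : nat} {U : ptopologicalType}.
Variable F : nat -> 'rV[R]_m -> U -> 'rV[R]_k -> 'rV[R]_m.
Variable Z : nat -> Om -> 'rV[R]_k.
Variable Adm : nat -> (Om -> 'rV[R]_m) -> set (Om -> U).
Variable ell : 'rV[R]_m -> 'rV[R]_d.

Local Notation val := (value P T Fil Theta Q prec F Z Adm ell).
Local Notation bell := (bellman P Fil Theta Q prec F Z Adm).
Local Notation back := (backward P Fil Theta Q prec F Z Adm ell).
Local Notation losses t S := (forall phi, admissible T F Z Adm t S phi ->
  L1 P (Fil T) (terminal_loss F Z ell t S phi)).

Lemma as_eqset_trans n (A B D : set (Om -> 'rV[R]_n)) :
  as_eqset P A B -> as_eqset P B D -> as_eqset P A D.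
Proof.
move=> [AB BA] [BD DB]; split=> [X AX|Z' DZ].
  have [Y BY XY] := AB _ AX; have [Z' DZ YZ] := BD _ BY.
  by exists Z' => //; exact: as_eq_trans YZ.
have [Y BY YZ] := DB _ DZ; have [X AX XY] := BA _ BY.
by exists X => //; exact: as_eq_trans YZ.
Qed.

Lemma as_eqset_sym n (A B : set (Om -> 'rV[R]_n)) :
  as_eqset P A B -> as_eqset P B A.
Proof.
by move=> [AB BA]; split=> [X /BA|X /AB] [Y YA XY]; exists Y => //;
  exact: as_eq_sym.
Qed.

Lemma losses_next t S u : (t < T)%N -> Adm t S u -> losses t S ->
  losses t.+1 (next_state F Z t S u).
Proof. by move=> tT Su LS phi Sphi; exact: (LS (u :: phi)). Qed.

Lemma value_L t S : (t <= T)%N -> losses t S -> val t S `<=` L t.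
Proof.
move=> tT LS Y; rewrite /value; case: ltnP => [tT'|Tt].
  move=> [phi Sphi ->]; have [] // := @vsupP t
    (fun theta => cE theta t (terminal_loss F Z ell t S phi)) tT.
  by move=> theta Th; apply: (cexp_L Th tT (leqnn T)); exact: LS.
have -> : t = T by apply/eqP; rewrite eqn_leq tT.
by move=> ->; apply: (LS [::]) => /=; apply/eqP; rewrite eqn_leq tT.
Qed.

Lemma bellman_L t S W : (t < T)%N ->
  (forall u, Adm t S u -> W (next_state F Z t S u) `<=` L t.+1) ->
  bell t S W `<=` L t.
Proof.
move=> tT LW _ [u [X [Su WX ->]]].
have [] // := @vsupP t (fun theta => cE theta t X) (ltnW tT).
by move=> theta Th; apply: (cexp_L Th (leqnSn t) tT); exact: LW WX.
Qed.

(** Integrability of the members of both sets is required for their conditional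
    expectations to depend only on their almost sure class. *)
Lemma bellman_as_eqset t S W W' : (t < T)%N ->
  (forall u, Adm t S u -> W (next_state F Z t S u) `<=` L t.+1) ->
  (forall u, Adm t S u -> W' (next_state F Z t S u) `<=` L t.+1) ->
  (forall u, Adm t S u -> as_eqset P (W (next_state F Z t S u))
                                     (W' (next_state F Z t S u))) ->
  as_eqset P (bell t S W) (bell t S W').
Proof.
move=> tT LW LW' WW'.
have eqX X X' : L t.+1 X -> L t.+1 X' -> as_eq P X X' ->
    as_eq P (vS t (fun theta => cE theta t X))
      (vS t (fun theta => cE theta t X')).
  move=> LX LX' XX'; apply: vsup_as_eq => [|theta Th|theta Th|theta Th].
  - exact: ltnW.
  - exact: (cexp_L Th (leqnSn t) tT LX).
  - exact: (cexp_L Th (leqnSn t) tT LX').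
  - exact: (cexp_as_eq Th (leqnSn t) tT LX LX' XX').
split=> [_ [u [X [Su WX ->]]]|_ [u [X' [Su WX' ->]]]].
  have [X' WX' XX'] := (WW' u Su).1 _ WX.
  exists (vS t (fun theta => cE theta t X')); first by exists u, X'.
  by apply: eqX XX'; [exact: LW WX|exact: LW' WX'].
have [X WX XX'] := (WW' u Su).2 _ WX'.
exists (vS t (fun theta => cE theta t X)); first by exists u, X.
by apply: eqX XX'; [exact: LW WX|exact: LW' WX'].
Qed.

Lemma value_bellman t S : (t < T)%N -> losses t S ->
  as_eqset P (val t S) (bell t S (val t.+1)).
Proof.
move=> tT LS; rewrite {1}/value tT; have [tT1|Tt1] := ltnP t.+1 T.
  have key u phi (S' := next_state F Z t S u) : Adm t S u ->
      admissible T F Z Adm t.+1 S' phi ->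
      as_eq P
        (vS t (fun theta => cE theta t (terminal_loss F Z ell t S (u :: phi))))
        (vS t (fun theta => cE theta t (vS t.+1 (fun theta' =>
           cE theta' t.+1 (terminal_loss F Z ell t.+1 S' phi))))).
    by move=> Su Sphi; apply: robust_tower => //; exact: (LS (u :: phi)).
  split=> [_ [[|u phi] /= Sphi ->]|_ [u [X [Su + ->]]]].
  - by rewrite Sphi ltnn in tT.
  - case: Sphi => _ Su Sphi; eexists; last exact: key.
    exists u; eexists; split; [exact: Su| |reflexivity].
    by rewrite /value tT1; exists phi.
  - rewrite /value tT1 => -[phi Sphi ->].
    by eexists; last exact: key; exists (u :: phi).
have T1 : t.+1 = T by apply/eqP; rewrite eqn_leq tT.
split=> [_ [[|u [|v phi]] /= Sphi ->]|_ [u [X [Su + ->]]]].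
- by rewrite Sphi ltnn in tT.
- case: Sphi => _ Su _; eexists; last exact: as_eq_refl.
  exists u; eexists; split; [exact: Su| |reflexivity].
  by rewrite /value ltnNge Tt1.
- by case: Sphi => _ _ [+ _ _]; rewrite ltnNge Tt1.
- rewrite /value ltnNge Tt1 /= => ->; eexists; last exact: as_eq_refl.
  by exists [:: u].
Qed.

Lemma value_backward n t S : (t + n)%N = T -> losses t S ->
  as_eqset P (val t S) (back n t S) /\ back n t S `<=` L t.
Proof.
elim: n t S => [|n IH] t S; rewrite ?addn0 => tn LS.
  have valE : val t S = back 0 t S by rewrite /value /= tn ltnn.
  split; last by rewrite -valE; apply: value_L => //; rewrite tn.
  by rewrite valE; split=> X ?; exists X => //; exact: as_eq_refl.
have tT : (t < T)%N by rewrite -tn addnS ltnS leq_addr.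
have next u : Adm t S u ->
    as_eqset P (val t.+1 (next_state F Z t S u))
      (back n t.+1 (next_state F Z t S u))
    /\ back n t.+1 (next_state F Z t S u) `<=` L t.+1.
  by move=> Su; apply: IH; [rewrite addSnnS|exact: losses_next].
split; last by apply: bellman_L => // u /next[].
apply: as_eqset_trans (value_bellman tT LS) _.
apply: bellman_as_eqset => // u Su; last exact: (next u Su).1.
  by apply: value_L => //; exact: losses_next.
exact: (next u Su).2.
Qed.

End Control.
End Model.

Theorem theorem3p8 (R : realType) (dO : measure_display)
    (Om : measurableType dO) (P : probability Om R)
    (T : nat) (Fil : nat -> set (set Om)) (hFil : filtration T Fil)
    (d : nat) (Theta : set 'rV[R]_d)
    (Theta_fin : finite_set Theta) (Theta_neq0 : Theta !=set0)
    (Q : 'rV[R]_d -> probability Om R)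
    (Q_ac : forall theta, Theta theta -> Q theta `<< P)
    (hE : cexp_well_defined P T Fil Theta Q)
    (prec : 'rV[R]_d -> 'rV[R]_d -> Prop) (hprec : vector_preorder prec)
    (m k : nat) (U : ptopologicalType)
    (SS : set 'rV[R]_m) (A : set U)
    (F : nat -> 'rV[R]_m -> U -> 'rV[R]_k -> 'rV[R]_m)
    (Z : nat -> Om -> 'rV[R]_k)
    (Adm : nat -> (Om -> 'rV[R]_m) -> set (Om -> U))
    (hctrl : control_setting T Fil SS A F Z Adm)
    (ell : 'rV[R]_m -> 'rV[R]_d)
    (hsup : finite_sups P T Fil Theta prec)
    (hanti : vantisymmetric prec)
    (hrect : rectangular P T Fil Theta Q prec)
    (t : nat) (ht : (t < T)%N)
    (S : Om -> 'rV[R]_m) (hS : is_state Fil SS t S)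
    (hell : forall phi, admissible T F Z Adm t S phi ->
       L1 P (Fil T) (terminal_loss F Z ell t S phi)) :
  as_eqset P
    (value P T Fil Theta Q prec F Z Adm ell t S)
    (bellman P Fil Theta Q prec F Z Adm t S
       (value P T Fil Theta Q prec F Z Adm ell t.+1)) /\
  as_eqset P
    (bellman P Fil Theta Q prec F Z Adm t S
       (value P T Fil Theta Q prec F Z Adm ell t.+1))
    (bellman_value P T Fil Theta Q prec F Z Adm ell t S).
Proof.
have main := value_bellman hFil Q_ac hE hprec hanti hsup hrect ht hell.
split; first exact: main.
apply: as_eqset_trans (as_eqset_sym main) _.
have tT : (t + (T - t))%N = T by rewrite subnKC// ltnW.
by have [] := value_backward hFil Q_ac hE hprec hanti hsup hrect tT hell.
Qed.
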